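(* There are absolute constants $c,C>0$ such that for every $m\ge1$ there exists a family of vectors $\mathcal{F}\subseteq\{0,1\}^m$ such that $P=\mathrm{conv}(\mathcal{F})$ contains a Euclidean ball of radius at least $c$, $P$ has unary facet complexity $1$, and if $X_1,X_2,\dots\in\mathcal{F}$ are independent uniform samples from $\mathcal{F}$, then for every $N\le2^m$, $$\Pr\Big[\frac1N\sum_{i=1}^N X_i\notin\partial P\Big]\le C\frac{N}{2^m},$$ where $\partial P$ denotes the boundary of $P$.
   Context: Unary facet complexity: for a polytope $P\subseteq\mathbb{R}^m$ with integer vertices, the smallest $M\in\mathbb{N}$ such that $P=\{x:\langle a_i,x\rangle\le b_i,\ i\in I\}\cap H$ with $I$ finite, $a_i\in\mathbb{Z}^m$, $\|a_i\|_\infty\le M$, $b_i\in\mathbb{R}$, $H$ a linear subspace of $\mathbb{R}^m$. *)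

(* Defs.v *)
From HB Require Import structures.
From mathcomp Require Import all_boot all_order all_algebra.
From mathcomp Require Import finmap.
From mathcomp Require Import all_classical all_reals all_analysis.
Set Implicit Arguments.
Unset Strict Implicit.
Unset Printing Implicit Defensive.
Import Order.TTheory GRing.Theory Num.Theory. Import numFieldNormedType.Exports.
Local Open Scope classical_set_scope.
Local Open Scope ring_scope.

Definition convex_hull (R : realType) (E : lmodType R) (A : set E) : set E :=
  smallest (@convex_set R E) A.

Definition frontier (T : topologicalType) (A : set T) : set T :=
  closure A `\` interior A.

(* The library's [ball] on ['rV[R]_m] is the one of the sup norm. *)
Definition euclidean_ball (R : realType) (m : nat) (x : 'rV[R]_m) (r : R) :
    set 'rV[R]_m :=
  [set y : 'rV[R]_m | Num.sqrt (\sum_(j < m) (y 0 j - x 0 j) ^+ 2) <= r].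

Definition real_point (R : realType) (m : nat) (v : 'rV[bool]_m) : 'rV[R]_m :=
  \row_(j < m) (v 0 j)%:R.

Definition cube_polytope (R : realType) (m : nat) (F : {set 'rV[bool]_m}) :
    set 'rV[R]_m :=
  convex_hull (@real_point R m @` [set` F]).

Arguments cube_polytope R {m} F _.

Definition facet_description (R : realType) (m : nat) (P : set 'rV[R]_m)
    (M : nat) : Prop :=
  exists (I : finType) (a : I -> 'rV[int]_m) (b : I -> R)
         (H : {vspace 'rV[R]_m}),
    (forall i j, `|a i 0 j| <= M%:Z) /\
    P = [set x : 'rV[R]_m | forall i, \sum_(j < m) (a i 0 j)%:~R * x 0 j <= b i]
        `&` [set x | x \in H].

(* [H] is a linear subspace, so not every lattice polytope has a description;
   the complexity is therefore a relation and not a total function. *)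
Definition unary_facet_complexity (R : realType) (m : nat) (P : set 'rV[R]_m)
    (M : nat) : Prop :=
  facet_description P M /\
  forall M', facet_description P M' -> (M <= M')%N.

(* [V] carries the discrete sigma-algebra in the next two definitions. *)
Definition uniform_sample (d : measure_display) (T : measurableType d)
    (R : realType) (mu : probability T R) (V : finType) (F : {set V})
    (X : T -> V) : Prop :=
  (forall A : set V, measurable (X @^-1` A)) /\
  (forall w, X w \in F) /\
  (forall v, v \in F -> mu (X @^-1` [set v]) = (#|F|%:R^-1)%:E).

Definition mutually_independent (d : measure_display) (T : measurableType d)
    (R : realType) (mu : probability T R) (V : finType)
    (X : nat -> T -> V) : Prop :=
  forall (J : {fset nat}) (A : nat -> set V),
    mu (\bigcap_(i in [set` J]) X i @^-1` A i) =
    (\prod_(i <- J) mu (X i @^-1` A i))%E.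

Definition sample_mean (R : realType) (m : nat) (T : Type)
    (X : nat -> T -> 'rV[bool]_m) (N : nat) (w : T) : 'rV[R]_m :=
  N%:R^-1 *: \sum_(i < N) real_point R (X i w).

(* Main.v *)
Require Import Defs.
From mathcomp Require Import all_boot all_order all_algebra.
From mathcomp Require Import all_classical all_reals all_analysis.
From mathcomp Require Import ring lra.
Import Order.TTheory GRing.Theory Num.Theory. Import numFieldNormedType.Exports.
Local Open Scope classical_set_scope.
Local Open Scope ring_scope.

(** Take for [P] the pyramid with base the cube [{0} x [0,1]^(m-1)] and apex
    [e_0]: its vertices are the points of [{0,1}^m] with first coordinate 0,
    together with [e_0], and its facets are [x_j >= 0] and [x_j + x_0 <= 1]
    (the bound [x_0 <= 1] is a facet only for [m = 1]). A sample mean lies in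
    the base facet [x_0 = 0] unless the apex has been drawn, and the union bound
    gives that event probability at most [N / (2 ^ (m - 1) + 1)]. *)

(** * Convex sets and the cube *)

Lemma convex_setP (R : realType) (E : lmodType R) (A : set E) :
  @convex_set R E A <->
  forall (x y : E) (t : R), 0 <= t -> t <= 1 -> A x -> A y ->
    A (t *: x + (1 - t) *: y).
Proof.
split=> [cA x y t t0 t1 Ax Ay|cA x y t].
  by have := cA x y (Itv01 t0 t1); rewrite !inE; apply.
by rewrite !inE => Ax Ay; apply: cA.
Qed.

Lemma convex_hull_convex (R : realType) (E : lmodType R) (A : set E) :
  @convex_set R E (convex_hull A).
Proof.
apply/convex_setP => x y t t0 t1 Ax Ay B [cB AB].
move/convex_setP: (cB); apply => //; [exact: Ax|exact: Ay].
Qed.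

(* The coordinates of [y] are rounded to 0 or 1 one at a time, [y] being a
   convex combination of its two roundings. *)
Lemma convex_box (R : realType) (m : nat) (S : pred 'I_m) (K : set 'rV[R]_m)
    (y : 'rV[R]_m) :
  @convex_set R 'rV[R]_m K ->
  (forall v : 'rV[bool]_m, (forall j, ~~ S j -> v 0 j = false) ->
    K (real_point R v)) ->
  (forall j, 0 <= y 0 j <= 1) -> (forall j, ~~ S j -> y 0 j = 0) -> K y.
Proof.
move=> /convex_setP cK vK.
(* Induction on [k], where the coordinates of index at least [k] are already 0 or 1. For [k = m]
   this demands nothing, and for [k = 0] the point [y] is a vertex. *)
suff cube k : (forall j, 0 <= y 0 j <= 1) -> (forall j, ~~ S j -> y 0 j = 0) ->
    (forall j : 'I_m, (k <= j)%N -> y 0 j = 0 \/ y 0 j = 1) -> K y.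
  move=> y01 yS; apply: (cube m y01 yS) => j.
  by rewrite leqNgt ltn_ord.
elim: k y => [|k IH] y y01 yS yk.
  have -> : y = real_point R (\row_j (y 0 j == 1)).
    apply/rowP => j; rewrite !mxE.
    by case: (yk j) => // ->; rewrite ?eqxx // eq_sym oner_eq0.
  by apply: vK => j Sj; rewrite mxE yS // eq_sym oner_eq0.
have [mk|km] := leqP m k.
  apply: IH => // j kj; move: (leq_trans mk kj).
  by rewrite leqNgt ltn_ord.
pose j0 := Ordinal km.
have kE (j : 'I_m) : (k <= j)%N -> j <> j0 -> (k < j)%N.
  rewrite leq_eqVlt => /orP[/eqP kj|//] jj0; exfalso; apply: jj0.
  exact: val_inj.
(* A zero coordinate is already rounded. Splitting it off ensures that [j0] lies in [S] whenever it
   has to be moved to 1. *)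
have [y0|y0] := eqVneq (y 0 j0) 0.
  apply: IH => // j kj; have [->|/eqP jj0] := eqVneq j j0; first by left.
  by apply: yk; exact: kE.
have Sj0 : S j0 by apply: contraNT y0 => /yS ->.
pose z a : 'rV[R]_m := \row_j (if j == j0 then a else y 0 j).
have -> : y = y 0 j0 *: z 1 + (1 - y 0 j0) *: z 0.
  by apply/rowP => j; rewrite !mxE; case: eqP => [->|_]; ring.
have [/andP[y00 y01'] Kz] : (0 <= y 0 j0 <= 1) /\
    forall a, a = 0 \/ a = 1 -> K (z a).
  split=> // a a01; apply: IH => j.
  - rewrite mxE; case: eqP => // _.
    by case: a01 => ->; rewrite lexx ler01.
  - by rewrite mxE; case: eqP => [->|_ /yS //]; rewrite Sj0.
  - by rewrite mxE; case: eqP => // jj0 kj; apply: yk; exact: kE.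
by apply: cK => //; apply: Kz; [right|left].
Qed.

(** * The pyramid as the hull of its vertices *)

Definition apex (n : nat) : 'rV[bool]_n.+1 := \row_j (j == ord0).

Definition pyramid_vertices (n : nat) : {set 'rV[bool]_n.+1} :=
  [set v : 'rV[bool]_n.+1 | ~~ v 0 ord0 || (v == apex n)].

Definition pyramid (R : realType) (n : nat) : set 'rV[R]_n.+1 :=
  [set x | (forall j, 0 <= x 0 j) /\ x 0 ord0 <= 1 /\
           forall j, j != ord0 -> x 0 j + x 0 ord0 <= 1].

Arguments pyramid R n _ : clear implicits.

Lemma pyramid_convex (R : realType) (n : nat) :
  @convex_set R 'rV[R]_n.+1 (pyramid R n).
Proof.
apply/convex_setP => x y t t0 t1 [x0 [x1 xj]] [y0 [y1 yj]].
have s0 : 0 <= 1 - t by rewrite subr_ge0.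
split; [|split].
- by move=> j; rewrite !mxE addr_ge0 // mulr_ge0.
- by rewrite !mxE; nra.
- by move=> j jn; rewrite !mxE; have := xj j jn; have := yj j jn; nra.
Qed.

Lemma cube_polytope_pyramid (R : realType) (n : nat) :
  cube_polytope R (pyramid_vertices n) = pyramid R n.
Proof.
apply/seteqP; split.
  apply: smallest_sub; first exact: pyramid_convex.
  move=> z [v /=]; rewrite inE => vF <-{z}; split; [|split].
  - by move=> j; rewrite mxE ler0n.
  - by rewrite mxE lern1 leq_b1.
  - move=> j jn; rewrite !mxE -natrD lern1.
    case/orP: vF => [/negbTE ->|/eqP ->]; first by rewrite addn0 leq_b1.
    by rewrite !mxE (negbTE jn).
move=> x [x0 [x1 xj]].
have cK := @convex_hull_convex R 'rV[R]_n.+1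
  (@real_point R n.+1 @` [set` pyramid_vertices n]).
have vK (v : 'rV[bool]_n.+1) : v \in pyramid_vertices n ->
    cube_polytope R (pyramid_vertices n) (real_point R v).
  by move=> vF; apply: sub_gen_smallest; exists v.
have aK : cube_polytope R (pyramid_vertices n) (real_point R (apex n)).
  by apply: vK; rewrite inE eqxx orbT.
(* At height 1 the inequalities force all other coordinates to vanish, leaving the apex; below it,
   division by [1 - x 0 ord0] is legitimate. *)
have [x1E|x1N] := eqVneq (x 0 ord0) 1.
  suff -> : x = real_point R (apex n) by [].
  apply/rowP => j; rewrite !mxE; case: eqP => [->//|/eqP jn].
  by have := xj j jn; have := x0 j; rewrite x1E /=; lra.
have t0 : 0 < 1 - x 0 ord0 by rewrite subr_gt0 lt_neqAle x1N.
(* The projection of [x] from the apex onto the base. The facet inequalities [x_j + x_0 <= 1] say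
   exactly that its coordinates are at most 1, so [convex_box] puts it in the hull of the base
   vertices. *)
pose y : 'rV[R]_n.+1 :=
  \row_j (if j == ord0 then 0 else x 0 j / (1 - x 0 ord0)).
have -> : x = x 0 ord0 *: real_point R (apex n) + (1 - x 0 ord0) *: y.
  apply/rowP => j; rewrite !mxE; case: eqP => [->|_] /=; first by ring.
  by field; rewrite gt_eqF.
move/convex_setP: (cK); apply => //.
apply: (@convex_box R n.+1 (fun j => j != ord0) _ y cK).
- by move=> v v0; apply: vK; rewrite inE v0 ?eqxx.
- move=> j; rewrite mxE; case: eqP => [_|/eqP jn]; first by rewrite lexx ler01.
  rewrite divr_ge0 ?(ltW t0) //= ler_pdivrMr // mul1r.
  by have := xj j jn; lra.
- by move=> j; rewrite negbK mxE => ->.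
Qed.

(** * Boundary and inscribed ball *)

Lemma pyramid_frontier (R : realType) (n : nat) (x : 'rV[R]_n.+1) :
  pyramid R n x -> x 0 ord0 = 0 -> frontier (pyramid R n) x.
Proof.
move=> Px x0; split; first exact: subset_closure.
rewrite /interior => /nbhs_ballP[e /= e0 eP].
(* Pushing [x] below the base by [e / 2] stays within sup-norm distance [e] but violates
   [x_0 >= 0]. *)
have : pyramid R n (\row_j (x 0 j - (j == ord0)%:R * (e / 2))).
  apply: eP; rewrite mx_norm_ball /ball_ /=.
  rewrite (_ : _ - _ = \row_j ((j == ord0)%:R * (e / 2))); last first.
    by apply/rowP => j; rewrite !mxE; ring.
  rewrite /Num.norm /= mx_normrE; apply: bigmax_lt => // -[i j] _.
  rewrite mxE /=; case: eqP => _; rewrite ?mul0r ?normr0 // mul1r.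
  by rewrite ger0_norm; lra.
by move=> [/(_ ord0)]; rewrite mxE x0 eqxx mul1r; lra.
Qed.

(** Each coordinate of a point of the ball is within 1/4 of 1/4, hence in [0, 1/2], so any two sum
    to at most 1. The radius does not depend on the dimension. *)
Lemma pyramid_ball (R : realType) (n : nat) :
  euclidean_ball (const_mx 4^-1 : 'rV[R]_n.+1) 4^-1 `<=` pyramid R n.
Proof.
move=> y yB.
have yj j : 0 <= y 0 j <= 2^-1.
  have : (y 0 j - 4^-1) ^+ 2 <= 4^-1 ^+ 2.
    rewrite -[_ <= _]ler_sqrt ?exprn_ge0 ?invr_ge0 ?ler0n //.
    rewrite [leRHS]sqrtr_sqr ger0_norm ?invr_ge0 ?ler0n //.
    apply: le_trans yB; rewrite ler_sqrt; last first.
      by apply: sumr_ge0 => i _; exact: sqr_ge0.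
    rewrite [leRHS](bigD1 j) //= mxE lerDl.
    by apply: sumr_ge0 => i _; exact: sqr_ge0.
  rewrite -ler_sqrt ?exprn_ge0 ?invr_ge0 ?ler0n // !sqrtr_sqr ler_norml.
  by rewrite (ger0_norm (x := 4^-1)) ?invr_ge0 ?ler0n //; lra.
split; [|split].
- by move=> j; case/andP: (yj j).
- by have := yj ord0; lra.
- by move=> j _; have := yj j; have := yj ord0; lra.
Qed.

(** * Unary facet complexity *)

Lemma pyramid_facet_description (R : realType) (n : nat) :
  facet_description (pyramid R n) 1.
Proof.
exists ('I_n.+1 + 'I_n.+1)%type.
exists (fun i => match i with
  | inl j => \row_k (if k == j then -1 else 0)
  (* At [j = ord0] the two tests coincide, so the row keeps coefficient 1 and encodes [x_0 <= 1]. *)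
  | inr j => \row_k (if (k == j) || (k == ord0) then 1 else 0) end).
exists (fun i => match i with inl _ => 0 | inr _ => 1 end).
exists fullv; split.
  by case=> i j; rewrite mxE; case: ifP.
have lE (x : 'rV[R]_n.+1) j : \sum_(k < n.+1)
    ((\row_k (if k == j then -1 else 0) : 'rV[int]_n.+1) 0 k)%:~R * x 0 k
    = - x 0 j.
  rewrite (bigD1 j) //= mxE eqxx big1 ?addr0 ?mulN1r // => k kj.
  by rewrite mxE (negbTE kj) mul0r.
have rE (x : 'rV[R]_n.+1) j : \sum_(k < n.+1) ((\row_k
    (if (k == j) || (k == ord0) then 1 else 0) : 'rV[int]_n.+1) 0 k)%:~R * x 0 k
    = x 0 j + (if j == ord0 then 0 else x 0 ord0).
  rewrite (bigD1 j) //= mxE eqxx mul1r; congr (_ + _).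
  case: eqP => [->|/eqP jn].
    by rewrite big1 // => k kj; rewrite mxE orbb (negbTE kj) mul0r.
  rewrite (bigD1 ord0) 1?eq_sym //= mxE eqxx orbT mul1r big1 ?addr0 // => k.
  by case/andP => kj k0; rewrite mxE (negbTE kj) (negbTE k0) mul0r.
apply/seteqP; split=> x.
  move=> [x0 [x1 xj]]; split; last by rewrite /= memvf.
  case=> j; first by rewrite lE oppr_le0.
  by rewrite rE; case: eqP => [->|/eqP /xj //]; rewrite addr0.
move=> [h _]; split; [|split].
- by move=> j; have := h (inl j); rewrite lE oppr_le0.
- by have := h (inr ord0); rewrite rE eqxx addr0.
- by move=> j /negbTE jn; have := h (inr j); rewrite rE jn.
Qed.

(* With [M = 0] all inequalities are trivial, so [P] would be a subspace,
   whereas the pyramid is bounded and nonzero. *)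
Lemma pyramid_facet_complexity (R : realType) (n : nat) :
  unary_facet_complexity (pyramid R n) 1.
Proof.
split; first exact: pyramid_facet_description.
case=> // -[I [a [b [H [a0 PE]]]]]; exfalso.
have {}a0 i (x : 'rV[R]_n.+1) : \sum_(j < n.+1) (a i 0 j)%:~R * x 0 j = 0.
  apply: big1 => j _.
  by have := a0 i j; rewrite normr_le0 => /eqP ->; rewrite mul0r.
have Pe : pyramid R n (delta_mx 0 ord0).
  split; [|split].
  - by move=> j; rewrite mxE ler0n.
  - by rewrite mxE.
  - by move=> j /negbTE jn; rewrite !mxE jn eqxx add0r.
(* The inequalities reduce to [0 <= b i], whatever the point, and [H] is closed under scaling; yet
   doubling the apex breaks [x_0 <= 1]. *)
have : pyramid R n (2 *: delta_mx 0 ord0).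
  move: Pe; rewrite PE => -[hb hH]; split; last exact: memvZ.
  by move=> i; have := hb i; rewrite !a0.
by case=> _ [+ _]; rewrite !mxE eqxx /=; lra.
Qed.

(** * Sampling from the vertices *)

(** Counts only the base vertices, obtained by prepending a zero to each point of the [n]-cube. *)
Lemma card_pyramid_vertices (n : nat) : (2 ^ n <= #|pyramid_vertices n|)%N.
Proof.
pose f (v : 'rV[bool]_n) : 'rV[bool]_n.+1 :=
  \row_j oapp (v 0) false (unlift ord0 j).
have f_inj : injective f.
  move=> u v /rowP uv; apply/rowP => j.
  by have := uv (lift ord0 j); rewrite !mxE liftK.
have <- : #|[set f v | v in [set: 'rV[bool]_n]]%SET| = (2 ^ n)%N.
  by rewrite card_imset // cardsT card_mx card_bool mul1n.
apply: subset_leq_card; apply/fintype.subsetP => _ /imsetP[v _ ->].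
by rewrite inE mxE unlift_none.
Qed.

Lemma sample_mean_frontier (R : realType) (n : nat) (T : Type)
    (X : nat -> T -> 'rV[bool]_n.+1) (N : nat) (w : T) :
  (0 < N)%N -> (forall i, (i < N)%N -> X i w \in pyramid_vertices n) ->
  (forall i, (i < N)%N -> X i w != apex n) ->
  frontier (pyramid R n) (sample_mean R X N w).
Proof.
move=> N0 XF Xa.
have X0 i : (i < N)%N -> X i w 0 ord0 = false.
  by move=> iN; have := XF i iN; rewrite inE (negbTE (Xa i iN)) orbF => /negbTE.
have mE j : sample_mean R X N w 0 j = N%:R^-1 * \sum_(i < N) (X i w 0 j)%:R.
  by rewrite mxE summxE; congr (_ * _); apply: eq_bigr => i _; rewrite mxE.
have m0 : sample_mean R X N w 0 ord0 = 0.
  by rewrite mE big1 ?mulr0 // => i _; rewrite X0.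
have m1 j : sample_mean R X N w 0 j <= 1.
  rewrite mE ler_pdivrMl ?ltr0n // mulr1 -natr_sum ler_nat.
  rewrite -[leqRHS]card_ord -sum1_card; apply: leq_sum => i _; exact: leq_b1.
apply: pyramid_frontier => //; split; [|split] => [j||j _].
- by rewrite mE mulr_ge0 ?invr_ge0 ?ler0n // sumr_ge0 // => i _; rewrite ler0n.
- exact: m1.
- by rewrite m0 addr0.
Qed.

(** The tuple of the first [N] samples takes finitely many values, so the event is a finite union of
    finite intersections of measurable preimages. This yields measurability of the bad event without
    studying the frontier as a set. *)
Lemma measurable_finite_sample (d : measure_display) (T : measurableType d)
    (V : finType) (X : nat -> T -> V) (N : nat) (B : set ({ffun 'I_N -> V})) :
  (forall i (A : set V), measurable (X i @^-1` A)) ->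
  measurable [set w | B [ffun i : 'I_N => X i w]].
Proof.
move=> mX.
rewrite (_ : [set w | _] =
  \bigcup_(f in B) \bigcap_(i in [set: 'I_N]) (X i @^-1` [set f i])).
  apply: fin_bigcup_measurable; first exact: finite_finset.
  move=> f _; apply: fin_bigcap_measurable => [|i _]; last exact: mX.
  exact: finite_finset.
apply/seteqP; split=> w /=.
  by move=> Bw; exists [ffun i : 'I_N => X i w] => // i _ /=; rewrite ffunE.
move=> [f Bf fw]; rewrite (_ : [ffun _ => _] = f) //.
by apply/ffunP => i; rewrite ffunE; exact: (fw i).
Qed.

Lemma prob_mean_not_frontier (R : realType) (n : nat) (d : measure_display)
    (T : measurableType d) (mu : probability T R)
    (X : nat -> T -> 'rV[bool]_n.+1) (N : nat) :
  (forall i, uniform_sample mu (pyramid_vertices n) (X i)) -> (0 < N)%N ->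
  (mu [set w | ~ frontier (pyramid R n) (sample_mean R X N w)]
    <= (2 * (N%:R / 2 ^+ n.+1))%:E)%E.
Proof.
move=> uX N0.
have mX i (A : set 'rV[bool]_n.+1) : measurable (X i @^-1` A).
  by case: (uX i).
set bad := [set w | _].
have badS : bad `<=` \big[setU/set0]_(i < N) (X i @^-1` [set apex n]).
  rewrite -(bigcup_mkord N (fun i => X i @^-1` [set apex n])).
  move=> w; apply: contra_notP => h.
  apply: sample_mean_frontier => // i iN; first by case: (uX i) => _ [].
  by apply/eqP => Xi; apply: h; exists i.
have mbad : measurable bad.
  (* The mean depends on [w] only through the tuple of samples. *)
  rewrite (_ : bad = [set w | [set f : {ffun 'I_N -> 'rV[bool]_n.+1} |
      ~ frontier (pyramid R n) (N%:R^-1 *: \sum_(i < N) real_point R (f i))]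
    [ffun i : 'I_N => X i w]]); first exact: measurable_finite_sample.
  apply/seteqP; split=> w /=; rewrite /sample_mean;
    by under [X in _ *: X]eq_bigr do rewrite ?ffunE.
apply: (@le_trans _ _ (mu (\big[setU/set0]_(i < N) (X i @^-1` [set apex n])))).
  by apply: le_measure; rewrite ?inE //; apply: bigsetU_measurable.
apply: (le_trans (Boole_inequality mu (fun i _ => mX i _))).
have aF : apex n \in pyramid_vertices n by rewrite inE eqxx orbT.
have aE i : mu (X i @^-1` [set apex n]) = (#|pyramid_vertices n|%:R^-1)%:E.
  by case: (uX i) => _ [_]; exact.
rewrite (eq_bigr (fun=> (#|pyramid_vertices n|%:R^-1)%:E)) => [|i _]; last first.
  exact: aE.
rewrite sumEFin lee_fin sumr_const card_ord.
(* The factor 2 compensates for the base having [2 ^ n] vertices, half of those of the full cube. *)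
rewrite (_ : 2 * _ = (2 ^+ n)^-1 *+ N).
  rewrite lerMn2r lef_pV2 ?posrE ?exprn_gt0 ?ltr0n //.
    by apply/orP; right; rewrite -natrX ler_nat card_pyramid_vertices.
  by apply/card_gt0P; exists (apex n).
by rewrite exprS -mulr_natr; field; rewrite expf_neq0.
Qed.

Theorem theoremA1 (R : realType) :
  exists c C : R, 0 < c /\ 0 < C /\
    forall m : nat, (1 <= m)%N ->
      exists F : {set 'rV[bool]_m},
        (exists (x : 'rV[R]_m) (r : R),
            c <= r /\ euclidean_ball x r `<=` cube_polytope R F) /\
        unary_facet_complexity (cube_polytope R F) 1 /\
        forall (d : measure_display) (T : measurableType d)
               (mu : probability T R) (X : nat -> T -> 'rV[bool]_m),
          (forall i, uniform_sample mu F (X i)) ->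
          mutually_independent mu X ->
          forall N : nat, (1 <= N <= 2 ^ m)%N ->
            (mu [set w | ~ frontier (cube_polytope R F) (sample_mean R X N w)]
             <= (C * (N%:R / 2 ^+ m))%:E)%E.
Proof.
(* The radius comes from [pyramid_ball], the constant 2 from [prob_mean_not_frontier]. *)
exists 4^-1, 2; split; first by rewrite invr_gt0 ltr0n.
split=> [//|[//|n] _]; exists (pyramid_vertices n).
rewrite cube_polytope_pyramid; split; last split.
- by exists (const_mx 4^-1), 4^-1; split=> //; exact: pyramid_ball.
- exact: pyramid_facet_complexity.
- move=> d T mu X uX _ N /andP[N0 _]; exact: prob_mean_not_frontier.
Qed.
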